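(* $$\sum_{k=0}^\infty\frac{(-1)^k}{\binom{2k}{k}^5}\left(684700k^4-1418358k^3+1100639k^2-365392k+47327\right)=\frac{231168-64\zeta(3)}{5}.$$
   Context: $\zeta(3)=\sum_{n=1}^\infty n^{-3}$. *)

(* Defs.v *)
From Stdlib Require Import Reals.
From Coquelicot Require Import Coquelicot.
Open Scope R_scope.

(* The sum is indexed by n = m + 1 with m >= 0.  [Series] is a total function:
   the value is meaningful only when the series converges, i.e. for s >= 2. *)
Definition zeta (s : nat) : R := Series (fun m : nat => / INR (S m) ^ s).

(* [C] alone would denote Coquelicot's complex numbers. *)
Definition central_binom (k : nat) : R := Binomial.C (2 * k) k.

(* Main.v *)
Require Import Defs.
From Stdlib Require Import Reals.
From Coquelicot Require Import Coquelicot.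
From Stdlib Require Import Factorial Lra Lia.
Open Scope R_scope.

(** The pair [F], [G] is a Wilf-Zeilberger pair going back to Markov's
    acceleration of the series sum of 1/(a+n)^3, with [F 0 m = 1/(m+1)^3].
    Moving the path of summation from the axis n = 0 to the diagonal n = m
    rewrites zeta(3) as the sum of [G n n + F (n+1) n], which is a rational
    function of n times (-1)^n / C(2n,n)^5 (the Amdeberhan-Zeilberger series).
    The series of the theorem differs from -64/5 times that one by the
    increments of (-1)^k Q(k) / C(2k,k)^5, where the quartic [Q] comes from
    Gosper's algorithm. *)

Definition F (n m : nat) : R :=
  (-1) ^ n * INR (fact n) ^ 6 * INR (fact m) ^ 4 * (2 * INR m + 2 + INR n) /
  (2 * INR (fact (2 * n)) * INR (fact (m + n + 1)) ^ 4).

Definition G (n m : nat) : R :=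
  (-1) ^ n * INR (fact n) ^ 6 * INR (fact m) ^ 4 *
  (5 * (INR n + 1) ^ 2 + 6 * INR m * (INR n + 1) + 2 * INR m ^ 2) /
  (4 * INR (fact (2 * n + 1)) * INR (fact (m + n + 1)) ^ 4).

Definition diag (n : nat) : R := G n n + F (S n) n.

Definition Q (x : R) : R :=
  668 * x ^ 4 + 2954 * x ^ 3 + 4959 * x ^ 2 + 3760 * x + 5467 / 5.

(** * The Wilf-Zeilberger relation and its summation over a triangle *)

Lemma INR_fact_S (n : nat) : INR (fact (S n)) = (INR n + 1) * INR (fact n).
Proof. now rewrite fact_simpl, mult_INR, S_INR. Qed.

Lemma INR_fact_double_S (n : nat) :
  INR (fact (2 * S n)) =
  (2 * INR n + 2) * (2 * INR n + 1) * INR (fact (2 * n)).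
Proof.
replace (2 * S n)%nat with (S (S (2 * n))) by lia.
rewrite !INR_fact_S, S_INR, mult_INR; simpl INR; ring.
Qed.

Lemma INR_fact_double_1 (n : nat) :
  INR (fact (2 * n + 1)) = (2 * INR n + 1) * INR (fact (2 * n)).
Proof.
replace (2 * n + 1)%nat with (S (2 * n)) by lia.
rewrite INR_fact_S, mult_INR; simpl INR; ring.
Qed.

(** Expressing every factorial through [n!], [m!], [(2n)!] and [(m+n+1)!] makes these cancel, which
    leaves an identity of rational functions in [n] and [m]. *)
Lemma wz_pair (n m : nat) : F n m - F (S n) m = G n m - G n (S m).
Proof.
unfold F, G.
replace (m + S n + 1)%nat with (S (m + n + 1)) by lia.
replace (S m + n + 1)%nat with (S (m + n + 1)) by lia.
rewrite INR_fact_double_1, INR_fact_double_S, !INR_fact_S, !S_INR, !plus_INR.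
change (INR 1) with 1; rewrite <- !tech_pow_Rmult.
assert (hn := pos_INR n); assert (hm := pos_INR m).
assert (h1 := INR_fact_neq_0 (2 * n)).
assert (h2 := INR_fact_neq_0 (m + n + 1)).
field; repeat split; lra.
Qed.

Lemma F_telescope (N m : nat) :
  sum_n (fun n => G n m) N - sum_n (fun n => G n (S m)) N =
  F 0 m - F (S N) m.
Proof.
induction N as [|N IH].
- now rewrite !sum_O, wz_pair.
- rewrite !sum_Sn; unfold plus; simpl.
  generalize (wz_pair (S N) m); lra.
Qed.

(** A discrete Green formula on the triangle [n <= m <= N]: the last sum is the contribution of the
    edge [m = N + 1]. Passing from [N] to [N + 1] adds one row, handled by [F_telescope] up to
    [n = N] and by one more instance of [wz_pair] at the corner on the diagonal. *)
Lemma sum_axis_diag (N : nat) :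
  sum_n (F 0) N = sum_n diag N - sum_n (fun n => G n (S N)) N.
Proof.
induction N as [|N IH].
- rewrite !sum_O; unfold diag; generalize (wz_pair 0 0); lra.
- rewrite !sum_Sn, IH; unfold plus; simpl.
  assert (H := F_telescope N (S N)).
  assert (W := wz_pair (S N) (S N)).
  change (diag (S N)) with (G (S N) (S N) + F (S (S N)) (S N)); lra.
Qed.

Lemma F_0 (m : nat) : F 0 m = / INR (S m) ^ 3.
Proof.
unfold F; replace (m + 0 + 1)%nat with (S m) by lia.
rewrite INR_fact_S, S_INR; simpl (fact _); simpl (INR 0); simpl (INR 1).
assert (hm := pos_INR m); assert (h := INR_fact_neq_0 m).
field; split; lra.
Qed.

(** * Decay of the edge term *)

Lemma fact_mul_le (n m : nat) : (fact n * fact (S m) <= fact (m + n + 1))%nat.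
Proof.
induction n as [|n IH].
- replace (m + 0 + 1)%nat with (S m) by lia; simpl (fact 0); lia.
- replace (m + S n + 1)%nat with (S (m + n + 1)) by lia.
  rewrite (fact_simpl n), (fact_simpl (m + n + 1)); nia.
Qed.

(** From [n!^2 <= (2n+1)!] and [n! (m+1)! <= (m+n+1)!] the quotient of factorials is at most
    [1/(m+1)^4]. Since [n + 1 <= m], the quadratic factor is at most [13 m^2], hence at most
    [16 (m+1)^2]; the 4 in the denominator of [G] then leaves the constant 4. *)
Lemma Rabs_G_le (n m : nat) :
  (n < m)%nat -> Rabs (G n m) <= 4 / (INR m + 1) ^ 2.
Proof.
intros hnm; unfold G.
assert (hx := pos_INR n).
assert (hxy : INR n + 1 <= INR m) by (rewrite <- S_INR; apply le_INR; lia).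
set (x := INR n) in *; set (y := INR m) in *.
assert (hA := INR_fact_lt_0 n); assert (hB := INR_fact_lt_0 m).
assert (hC := INR_fact_lt_0 (2 * n + 1)).
assert (hD := INR_fact_lt_0 (m + n + 1)).
assert (hAC : INR (fact n) ^ 2 <= INR (fact (2 * n + 1))).
{ replace (INR (fact n) ^ 2) with (INR (fact n * fact n))
    by (rewrite mult_INR; ring).
  apply le_INR; generalize (fact_mul_le n n) (fact_simpl n).
  replace (n + n + 1)%nat with (2 * n + 1)%nat by lia; nia. }
assert (hABD : INR (fact n) * ((y + 1) * INR (fact m)) <=
               INR (fact (m + n + 1))).
{ unfold y; rewrite <- INR_fact_S, <- mult_INR; apply le_INR, fact_mul_le. }
set (A := INR (fact n)) in *; set (B := INR (fact m)) in *.
set (C := INR (fact (2 * n + 1))) in *.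
set (D := INR (fact (m + n + 1))) in *.
set (q := 5 * (x + 1) ^ 2 + 6 * y * (x + 1) + 2 * y ^ 2).
assert (hq0 : 0 <= q) by (unfold q; nra).
assert (hq : q <= 16 * (y + 1) ^ 2) by (unfold q; nra).
assert (hAB : 0 < A * B) by nra.
assert (hden : 0 < 4 * C * D ^ 4)
  by (apply Rmult_lt_0_compat; [lra | now apply pow_lt]).
assert (hnum : 0 <= A ^ 6 * B ^ 4 * q)
  by (repeat apply Rmult_le_pos; try apply pow_le; lra).
replace ((-1) ^ n * A ^ 6 * B ^ 4 * q / (4 * C * D ^ 4))
  with ((-1) ^ n * (A ^ 6 * B ^ 4 * q / (4 * C * D ^ 4))) by (field; lra).
rewrite Rabs_mult, pow_1_abs, Rmult_1_l, Rabs_pos_eq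
  by (now apply Rle_mult_inv_pos).
apply Rmult_le_reg_r with (4 * C * D ^ 4); [exact hden|].
unfold Rdiv; rewrite Rmult_assoc, Rinv_l, Rmult_1_r by lra.
apply Rmult_le_reg_r with ((y + 1) ^ 2); [apply pow_lt; lra|].
replace (4 * / (y + 1) ^ 2 * (4 * C * D ^ 4) * (y + 1) ^ 2)
  with (16 * (C * D ^ 4)) by (field; lra).
assert (hD4 : (A * ((y + 1) * B)) ^ 4 <= D ^ 4) by (apply pow_incr; nra).
assert (hCD : A ^ 2 * (A * ((y + 1) * B)) ^ 4 <= C * D ^ 4).
{ apply Rmult_le_compat; auto; apply pow_le; nra. }
apply Rle_trans with (16 * (A ^ 2 * (A * ((y + 1) * B)) ^ 4)); [|lra].
replace (16 * (A ^ 2 * (A * ((y + 1) * B)) ^ 4))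
  with (A ^ 6 * B ^ 4 * (y + 1) ^ 2 * (16 * (y + 1) ^ 2)) by ring.
replace (A ^ 6 * B ^ 4 * q * (y + 1) ^ 2)
  with (A ^ 6 * B ^ 4 * (y + 1) ^ 2 * q) by ring.
apply Rmult_le_compat_l; [|exact hq].
repeat apply Rmult_le_pos; try apply pow_le; lra.
Qed.

Lemma Rabs_sum_n_le (u : nat -> R) (c : R) (N : nat) :
  (forall n, (n <= N)%nat -> Rabs (u n) <= c) ->
  Rabs (sum_n u N) <= (INR N + 1) * c.
Proof.
intros h; rewrite <- S_INR, <- sum_n_const, !sum_n_Reals.
apply Rle_trans with (1 := Rsum_abs u N); apply sum_Rle; exact h.
Qed.

Lemma is_lim_seq_inv_INR_S (c : R) :
  is_lim_seq (fun N => c * / INR (S N)) 0.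
Proof.
replace (Finite 0) with (Rbar_mult c 0) by (simpl; f_equal; ring).
apply is_lim_seq_scal_l.
apply (is_lim_seq_incr_1 (fun n => / INR n)).
apply (is_lim_seq_inv _ p_infty); [exact is_lim_seq_INR | discriminate].
Qed.

Lemma is_lim_seq_le_inv_INR_S (u : nat -> R) (c : R) :
  (forall N, Rabs (u N) <= c * / INR (S N)) -> is_lim_seq u 0.
Proof.
intros h; apply is_lim_seq_abs_0.
apply is_lim_seq_le_le with (fun _ => 0) (fun N => c * / INR (S N)).
- intros N; split; [apply Rabs_pos | apply h].
- apply is_lim_seq_const.
- apply is_lim_seq_inv_INR_S.
Qed.

Lemma is_lim_seq_sum_G : is_lim_seq (fun N => sum_n (fun n => G n (S N)) N) 0.
Proof.
apply is_lim_seq_le_inv_INR_S with 4; intros N.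
(* There are [N + 1] terms, each at most [4/(N+2)^2], so the sum is [O(1/N)]. *)
apply Rle_trans with ((INR N + 1) * (4 / (INR (S N) + 1) ^ 2)).
- apply Rabs_sum_n_le; intros n hn; apply Rabs_G_le; lia.
- rewrite S_INR; assert (h := pos_INR N); set (x := INR N) in *.
  apply Rmult_le_reg_r with ((x + 1 + 1) ^ 2 * (x + 1)).
  { apply Rmult_lt_0_compat; [apply pow_lt|]; lra. }
  replace ((x + 1) * (4 / (x + 1 + 1) ^ 2) * ((x + 1 + 1) ^ 2 * (x + 1)))
    with (4 * (x + 1) ^ 2) by (field; lra).
  replace (4 * / (x + 1) * ((x + 1 + 1) ^ 2 * (x + 1)))
    with (4 * (x + 1 + 1) ^ 2) by (field; lra).
  nra.
Qed.

(** * Convergence of both series to zeta(3) *)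

Lemma is_series_zeta_3 : is_series (fun m => / INR (S m) ^ 3) (zeta 3).
Proof.
apply Series_correct.
assert (hpos : forall m, 0 < INR (S m)) by (intros m; apply lt_0_INR; lia).
(* Comparison with a telescoping sum: [1/(x+1)^3 <= 1/x - 1/(x+1)] for [x > 0]. *)
assert (hbound : forall N, sum_n (fun m => / INR (S m) ^ 3) N <=
                           2 - / INR (S N)).
{ induction N as [|N IH]; [rewrite sum_O; simpl; lra|].
  rewrite sum_Sn; change (@plus R_AbelianMonoid) with Rplus.
  assert (h := hpos N); rewrite (S_INR (S N)); set (x := INR (S N)) in *.
  apply Rle_trans with (2 - / x + / (x + 1) ^ 3);
    [apply Rplus_le_compat_r, IH|].
  assert (H : / x - / (x + 1) - / (x + 1) ^ 3 =
              (x ^ 2 + x + 1) / (x * (x + 1) ^ 3)) by (field; lra).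
  assert (0 <= (x ^ 2 + x + 1) / (x * (x + 1) ^ 3)).
  { apply Rle_mult_inv_pos; [nra|].
    apply Rmult_lt_0_compat; [|apply pow_lt]; lra. }
  lra. }
destruct (ex_finite_lim_seq_incr (sum_n (fun m => / INR (S m) ^ 3)) 2)
  as [l hl].
- intros N; rewrite sum_Sn; change (@plus R_AbelianMonoid) with Rplus.
  assert (h := Rinv_0_lt_compat _ (pow_lt _ 3 (hpos (S N)))).
  apply Rle_trans with (sum_n (fun m => / INR (S m) ^ 3) N + 0);
    [lra | apply Rplus_le_compat_l; lra].
- intros N; assert (h := Rinv_0_lt_compat _ (hpos N)).
  generalize (hbound N); lra.
- now exists l.
Qed.

Lemma is_series_diag : is_series diag (zeta 3).
Proof.
change (is_lim_seq (sum_n diag) (zeta 3)).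
apply is_lim_seq_ext with
  (fun N => sum_n (F 0) N + sum_n (fun n => G n (S N)) N).
{ intros N; rewrite sum_axis_diag; ring. }
rewrite <- (Rplus_0_r (zeta 3)).
apply is_lim_seq_plus'; [|exact is_lim_seq_sum_G].
apply is_lim_seq_ext with (2 := is_series_zeta_3).
intros N; apply sum_n_ext; intros m; symmetry; apply F_0.
Qed.

(** * Passage to central binomial coefficients *)

Lemma central_binom_fact (k : nat) :
  central_binom k = INR (fact (2 * k)) / INR (fact k) ^ 2.
Proof.
unfold central_binom, Binomial.C.
replace (2 * k - k)%nat with k by lia.
f_equal; ring.
Qed.

Lemma central_binom_S (k : nat) :
  central_binom (S k) =
  central_binom k * (2 * (2 * INR k + 1)) / (INR k + 1).
Proof.
rewrite !central_binom_fact, INR_fact_double_S, INR_fact_S.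
assert (h := INR_fact_neq_0 k); assert (hk := pos_INR k).
field; split; lra.
Qed.

Lemma central_binom_ge (k : nat) : INR (S k) <= central_binom k.
Proof.
induction k as [|k IH].
- rewrite central_binom_fact; simpl; lra.
- rewrite central_binom_S, !S_INR; rewrite S_INR in IH.
  assert (hk := pos_INR k).
  apply Rmult_le_reg_r with (INR k + 1); [lra|].
  unfold Rdiv; rewrite Rmult_assoc, Rinv_l by lra; nra.
Qed.

Lemma diag_central_binom (n : nat) :
  diag n = (205 * INR n ^ 2 + 250 * INR n + 77) /
           (64 * (2 * INR n + 1) ^ 5) * ((-1) ^ n / central_binom n ^ 5).
Proof.
unfold diag, F, G; rewrite central_binom_fact.
replace (n + S n + 1)%nat with (2 * S n)%nat by lia.
replace (n + n + 1)%nat with (2 * n + 1)%nat by lia.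
rewrite INR_fact_double_S, INR_fact_double_1, INR_fact_S, S_INR.
rewrite <- (tech_pow_Rmult (-1) n).
assert (hn := pos_INR n).
assert (h1 := INR_fact_neq_0 (2 * n)); assert (h2 := INR_fact_neq_0 n).
field; repeat split; lra.
Qed.

(** With [R k = Q k (-1)^k / C(2k,k)^5], the summand at [k + 1] equals
    [-64/5 * diag k + R (k+1) - R k]. Hence the index shift between the two sums, and the constant
    is the summand at 0 minus [R 0]: [47327 - 5467/5 = 231168/5]. The induction starts at [S N]
    because [sum_n diag] always has at least one term. *)
Lemma sum_n_quartic_central_binom (N : nat) :
  sum_n (fun k : nat =>
       (-1) ^ k / central_binom k ^ 5 *
       (684700 * INR k ^ 4 - 1418358 * INR k ^ 3 + 1100639 * INR k ^ 2
        - 365392 * INR k + 47327)) (S N) =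
  231168 / 5 - 64 / 5 * sum_n diag N +
  Q (INR (S N)) * ((-1) ^ S N / central_binom (S N) ^ 5).
Proof.
induction N as [|N IH].
- rewrite sum_Sn, !sum_O, diag_central_binom, central_binom_S.
  rewrite central_binom_fact; unfold plus, Q; simpl; field.
- rewrite sum_Sn, IH, (sum_Sn diag), diag_central_binom.
  (* Both [diag (S N)] and the new power of a central binomial now have denominators dividing a
     multiple of [(2x+1)^5 c^5], so a polynomial identity in [x] remains; [hc] gives [c <> 0]. *)
  rewrite (central_binom_S (S N)), (S_INR (S N)).
  rewrite <- (tech_pow_Rmult _ (S N)).
  assert (hx := pos_INR (S N)).
  assert (hc := central_binom_ge (S N)); rewrite S_INR in hc.
  set (x := INR (S N)) in *; set (c := central_binom (S N)) in *.
  unfold plus, Q; simpl.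
  field; repeat split; lra.
Qed.

Lemma is_lim_seq_Q_central_binom :
  is_lim_seq (fun k => Q (INR k) * ((-1) ^ k / central_binom k ^ 5)) 0.
Proof.
(* 13435 is the sum of the coefficients of [Q], rounded up. As [C(2k,k) >= k + 1], the fifth power
   exceeds the quartic growth of [Q] by one degree. *)
apply is_lim_seq_le_inv_INR_S with 13435; intros k.
assert (hc := central_binom_ge k).
rewrite S_INR in *; assert (hx := pos_INR k).
set (x := INR k) in *; set (c := central_binom k) in *.
assert (hQ : 0 <= Q x <= 13435 * (x + 1) ^ 4).
{ assert (0 <= x ^ 2) by (apply pow_le; lra).
  assert (0 <= x ^ 3) by (apply pow_le; lra).
  assert (0 <= x ^ 4) by (apply pow_le; lra).
  unfold Q; split; [lra|].
  replace ((x + 1) ^ 4) with (x ^ 4 + 4 * x ^ 3 + 6 * x ^ 2 + 4 * x + 1)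
    by ring; lra. }
assert (h5 : (x + 1) ^ 5 <= c ^ 5) by (apply pow_incr; lra).
assert (hx5 : 0 < (x + 1) ^ 5) by (apply pow_lt; lra).
unfold Rdiv; rewrite !Rabs_mult, pow_1_abs, Rabs_inv, Rmult_1_l.
rewrite (Rabs_pos_eq (Q x)), (Rabs_pos_eq (c ^ 5)) by lra.
apply Rle_trans with (13435 * (x + 1) ^ 4 * / (x + 1) ^ 5).
- apply Rmult_le_compat; try lra.
  + left; apply Rinv_0_lt_compat; lra.
  + apply Rinv_le_contravar; lra.
- right; field; lra.
Qed.

Theorem theorem1p3 :
  is_series
    (fun k : nat =>
       (-1) ^ k / central_binom k ^ 5 *
       (684700 * INR k ^ 4 - 1418358 * INR k ^ 3 + 1100639 * INR k ^ 2
        - 365392 * INR k + 47327))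
    ((231168 - 64 * zeta 3) / 5).
Proof.
match goal with |- is_series ?a ?l =>
  change (is_lim_seq (sum_n a) l) end.
apply is_lim_seq_incr_1.
apply is_lim_seq_ext with (u := fun N =>
  231168 / 5 - 64 / 5 * sum_n diag N +
  Q (INR (S N)) * ((-1) ^ S N / central_binom (S N) ^ 5)).
{ intros N; symmetry; apply sum_n_quartic_central_binom. }
replace ((231168 - 64 * zeta 3) / 5)
  with (231168 / 5 - 64 / 5 * zeta 3 + 0) by field.
apply is_lim_seq_plus'.
- apply is_lim_seq_minus'; [apply is_lim_seq_const|].
  apply (is_lim_seq_scal_l (sum_n diag) (64 / 5) (zeta 3)).
  exact is_series_diag.
- apply (is_lim_seq_incr_1
    (fun k => Q (INR k) * ((-1) ^ k / central_binom k ^ 5))).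
  exact is_lim_seq_Q_central_binom.
Qed.
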